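(* Let $q\in\mathbb{C}$ with $|q|<1$, let $\alpha,\gamma\in\mathbb{C}$, and let $\beta\in\mathbb{C}$ with $\beta\notin\{0,\ \alpha q,\ \gamma q\}\cup\{q^{-j}: j\ge 0\}\cup\{\alpha\gamma q^{j+2}: j\geq 0\}$. Then $$\sum_{n=0}^\infty\frac{(\alpha;q)_n(\gamma;q)_n}{(\beta;q)_n(\alpha\gamma q^2/\beta;q)_n}q^n=\frac{\beta^{-1}q}{(1-\alpha q/\beta)(1-\gamma q/\beta)}\cdot \frac{(\alpha;q)_\infty(\gamma;q)_\infty}{(\beta;q)_\infty(\alpha\gamma q^2/\beta;q)_\infty}+\frac{(1-q/\beta)(1-\alpha\gamma q/\beta)}{(1-\gamma q/\beta)(1-\alpha q/\beta)}.$$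
   Context: For $A\in\mathbb{C}$ and $|q|<1$: $(A;q)_n=\prod_{j=1}^{n}(1-Aq^{j-1})$ for integers $n\ge 0$ (so $(A;q)_0=1$), and $(A;q)_\infty=\lim_{n\to\infty}(A;q)_n$. *)

(* Defs.v *)
From Stdlib Require Import Reals.
From Coquelicot Require Import Coquelicot.
Open Scope C_scope.

(** The factor at step [S n] is the one of index [j = n + 1], that is
    [1 - A q^(j-1)]. *)
Fixpoint qpoch (A q : C) (n : nat) : C :=
  match n with
  | O => 1
  | S n => qpoch A q n * (1 - A * q ^ n)
  end.

(** Limit in [C] of [qpoch A q n]; [iota] is a total choice operator, with an
    unspecified value if the limit does not exist (it exists for [Cmod q < 1]). *)
Definition qpoch_inf (A q : C) : C :=
  @iota C_CompleteNormedModule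
    (fun l : C => filterlim (qpoch A q) eventually (locally l)).

(* Main.v *)
Require Import Defs.
From Stdlib Require Import Reals Lra.
From Coquelicot Require Import Coquelicot.
Open Scope C_scope.

(** The series telescopes. With [x = q^n] and [P n] the coefficient of [q^n],
    put [S n = P n (q/beta - x) (1 - alpha gamma q x / beta) / D], where
    [D = (1 - alpha q/beta) (1 - gamma q/beta)]. Then
    [P n q^n = S (n+1) - S n] because
    [(1 - alpha x) (1 - gamma x) q/beta
       - (q/beta - x) (1 - alpha gamma q x / beta) = x D],
    and [- S 0] and [lim S] are the two terms of the right-hand side. *)

(** * Limits of complex sequences *)

Lemma filterlim_C_Cmod (u : nat -> C) (l : C) :
  filterlim u eventually (locally l) <->
  is_lim_seq (fun n => Cmod (u n - l)) 0%R.
Proof.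
  rewrite <- is_lim_seq_spec.
  split.
  - intros H eps.
    (* [locally l] refers to the product uniform structure on [C]; [locally_C] passes to the one
       whose balls are given by [Cmod]. *)
    assert (H' : filterlim u eventually
                   (locally (T := AbsRing_UniformSpace C_AbsRing) l)).
    { intros P HP. apply H. now apply locally_C. }
    generalize (proj1 (filterlim_locally (U := AbsRing_UniformSpace C_AbsRing) u l) H' eps).
    apply filter_imp; intros n Hn.
    rewrite Rminus_0_r, Rabs_pos_eq by apply Cmod_ge_0.
    exact Hn.
  - intros H P HP.
    apply locally_C in HP. revert P HP.
    apply (proj2 (filterlim_locally (U := AbsRing_UniformSpace C_AbsRing) u l)).
    intros eps. generalize (H eps).
    apply filter_imp; intros n Hn.
    rewrite Rminus_0_r, Rabs_pos_eq in Hn by apply Cmod_ge_0.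
    exact Hn.
Qed.

Lemma is_lim_seq_Cmod (u : nat -> C) (l : C) :
  filterlim u eventually (locally l) -> is_lim_seq (fun n => Cmod (u n)) (Cmod l).
Proof.
  intros H.
  exact (filterlim_comp _ _ _ u (fun z => Cmod z) _ _ _ H
           (filterlim_norm (V := C_NormedModule) l)).
Qed.

Lemma filterlim_C_plus (u v : nat -> C) (a b : C) :
  filterlim u eventually (locally a) -> filterlim v eventually (locally b) ->
  filterlim (fun n => u n + v n) eventually (locally (a + b)).
Proof.
  intros Hu Hv.
  exact (filterlim_comp_2 _ _ _ Hu Hv
           (filterlim_plus (V := C_NormedModule) a b)).
Qed.

Lemma filterlim_C_mult (u v : nat -> C) (a b : C) :
  filterlim u eventually (locally a) -> filterlim v eventually (locally b) ->
  filterlim (fun n => u n * v n) eventually (locally (a * b)).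
Proof.
  intros Hu Hv.
  (* The product is read as scalar multiplication of [C] on itself, whose scalar argument carries
     the [Cmod] uniform structure. *)
  assert (Hu' : filterlim u eventually
                  (locally (T := AbsRing_UniformSpace C_AbsRing) a)).
  { intros P HP. apply Hu. now apply locally_C. }
  exact (filterlim_comp_2 _ _ _ Hu' Hv
           (filterlim_scal (K := C_AbsRing) (V := C_NormedModule) a b)).
Qed.

(** Rests on [|1/u - 1/l| = |u - l| / (|u| |l|)], valid as soon as [u] is nonzero. *)
Lemma filterlim_C_inv (u : nat -> C) (l : C) :
  l <> 0 -> filterlim u eventually (locally l) ->
  filterlim (fun n => / u n) eventually (locally (/ l)).
Proof.
  intros Hl H.
  pose proof (is_lim_seq_Cmod _ _ H) as HM.
  apply filterlim_C_Cmod in H.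
  apply filterlim_C_Cmod.
  assert (Hl' : (0 < Cmod l)%R) by now apply Cmod_gt_0.
  apply is_lim_seq_ext_loc
    with (fun n => (Cmod (u n - l) * (/ Cmod (u n) * / Cmod l))%R).
  (* Eventually [Cmod (u n)] is at distance less than [Cmod l] from [Cmod l], which excludes
     [u n = 0]. *)
  - pose proof (proj2 (is_lim_seq_spec _ _) HM (mkposreal _ Hl')) as Hev.
    revert Hev. apply filter_imp; intros n Hn; simpl in Hn.
    assert (Hu : u n <> 0).
    { intros E. rewrite E, Cmod_0 in Hn.
      unfold Rminus in Hn. rewrite Rplus_0_l, Rabs_Ropp, Rabs_pos_eq in Hn; lra. }
    rewrite <- !Cmod_inv by assumption.
    rewrite <- !Cmod_mult, <- (Cmod_opp (_ * _)).
    f_equal. now field.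
  - replace 0%R with (0 * (/ Cmod l * / Cmod l))%R by ring.
    apply is_lim_seq_mult'; [exact H|].
    apply is_lim_seq_mult'; [|apply is_lim_seq_const].
    apply (is_lim_seq_inv _ _ HM). intros E; injection E; lra.
Qed.

Lemma filterlim_C_pow (q : C) :
  (Cmod q < 1)%R -> filterlim (fun n => q ^ n) eventually (locally (0 : C)).
Proof.
  intros hq. apply filterlim_C_Cmod.
  apply is_lim_seq_ext with (fun n => (Cmod q ^ n)%R).
  - intros n. rewrite <- Cmod_pow. f_equal. ring.
  - apply is_lim_seq_geom. rewrite Rabs_pos_eq; [exact hq | apply Cmod_ge_0].
Qed.

(** * Bounds, convergence and non-vanishing of the q-Pochhammer products *)

Lemma qpoch_bound (A q : C) (n : nat) :
  (Cmod q < 1)%R ->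
  (Cmod (qpoch A q n) <= exp (Cmod A / (1 - Cmod q)))%R.
Proof.
  intros hq.
  pose proof (Cmod_ge_0 A) as hA. pose proof (Cmod_ge_0 q) as hq0.
  (* Each factor is at most [1 + |A| |q|^n <= exp (|A| |q|^n)]. The induction carries the exact
     geometric partial sum in the exponent, since the bound uniform in [n] is not inductive. *)
  apply Rle_trans with (exp (Cmod A * (1 - Cmod q ^ n) / (1 - Cmod q))).
  - induction n as [|n IH].
    + simpl. rewrite Cmod_1.
      replace (_ / _)%R with 0%R by (field; lra). rewrite exp_0; lra.
    + simpl qpoch. rewrite Cmod_mult.
      replace (Cmod A * (1 - Cmod q ^ S n) / (1 - Cmod q))%R
        with (Cmod A * (1 - Cmod q ^ n) / (1 - Cmod q) + Cmod A * Cmod q ^ n)%R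
        by (simpl; field; lra).
      rewrite exp_plus.
      apply Rmult_le_compat; try apply Cmod_ge_0; [exact IH|].
      apply Rle_trans with (1 + Cmod A * Cmod q ^ n)%R; [|apply exp_ineq1_le].
      rewrite <- Cmod_pow, <- Cmod_mult, <- (Cmod_opp (A * q ^ n)).
      pose proof (Cmod_triangle 1 (- (A * q ^ n))) as ht.
      now rewrite Cmod_1 in ht.
  - assert (0 <= Cmod q ^ n)%R by now apply pow_le.
    assert (hle : (Cmod A * (1 - Cmod q ^ n) / (1 - Cmod q) <= Cmod A / (1 - Cmod q))%R).
    { apply Rmult_le_compat_r; [|nra].
      apply Rlt_le, Rinv_0_lt_compat; lra. }
    destruct hle as [hlt|heq];
      [left; now apply exp_increasing | rewrite heq; lra].
Qed.

(** Weierstrass' inequality: a product of factors [1 - b_j] with [0 <= b_j <= 1] is at least one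
    minus the sum of the [b_j], here with [b_j = |A| |q|^j]. *)
Lemma qpoch_lower_bound (A q : C) (n : nat) :
  (Cmod q < 1)%R -> (Cmod A <= 1 - Cmod q)%R ->
  (1 - Cmod A / (1 - Cmod q) <= Cmod (qpoch A q n))%R.
Proof.
  intros hq hAq.
  pose proof (Cmod_ge_0 A) as hA. pose proof (Cmod_ge_0 q) as hq0.
  assert (hpow : forall k, (0 <= Cmod q ^ k <= 1)%R).
  { intros k. split; [now apply pow_le|].
    rewrite <- (pow1 k). apply pow_incr; lra. }
  assert (hinv : (0 < / (1 - Cmod q))%R) by (apply Rinv_0_lt_compat; lra).
  apply Rle_trans with (1 - Cmod A * (1 - Cmod q ^ n) / (1 - Cmod q))%R.
  { apply Rplus_le_compat_l, Ropp_le_contravar.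
    apply Rmult_le_compat_r; [lra|]. specialize (hpow n); nra. }
  induction n as [|n IH].
  - simpl. rewrite Cmod_1. right; field; lra.
  - simpl qpoch. rewrite Cmod_mult.
    replace (Cmod A * (1 - Cmod q ^ S n) / (1 - Cmod q))%R
      with (Cmod A * (1 - Cmod q ^ n) / (1 - Cmod q) + Cmod A * Cmod q ^ n)%R
      by (simpl; field; lra).
    set (s := (Cmod A * (1 - Cmod q ^ n) / (1 - Cmod q))%R) in *.
    set (b := (Cmod A * Cmod q ^ n)%R).
    assert (hs : (0 <= s)%R).
    { apply Rmult_le_pos; [|lra]. specialize (hpow n); nra. }
    assert (hb : (0 <= b <= 1)%R) by (unfold b; specialize (hpow n); nra).
    assert (hf : (1 - b <= Cmod (1 - A * q ^ n))%R).
    { pose proof (Cmod_triangle (1 - A * q ^ n) (A * q ^ n)) as ht.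
      replace (1 - A * q ^ n + A * q ^ n) with (RtoC 1) in ht by ring.
      rewrite Cmod_1, (Cmod_mult A), Cmod_pow in ht. fold b in ht. lra. }
    pose proof (Cmod_ge_0 (qpoch A q n)).
    (* [(1 - s) (1 - b) = 1 - s - b + s b], and [s b >= 0]; [b <= 1] allows multiplying the
       induction hypothesis by [1 - b]. *)
    nra.
Qed.

Lemma qpoch_add (A q : C) (m n : nat) :
  qpoch A q (m + n) = qpoch A q m * qpoch (A * q ^ m) q n.
Proof.
  induction n as [|n IH].
  - rewrite Nat.add_0_r. simpl. ring.
  - rewrite Nat.add_succ_r. simpl. rewrite IH, Cpow_add_r. ring.
Qed.

Lemma qpoch_neq_0 (A q : C) (n : nat) :
  (forall k, 1 - A * q ^ k <> 0) -> qpoch A q n <> 0.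
Proof.
  intros h. induction n as [|n IH]; simpl.
  - apply C1_nz.
  - now apply Cmult_neq_0.
Qed.

(** The increments [- qpoch A q n * A * q ^ n] are dominated by a geometric series because the
    products are bounded, so they are summable. *)
Lemma qpoch_inf_lim (A q : C) :
  (Cmod q < 1)%R ->
  filterlim (qpoch A q) eventually (locally (qpoch_inf A q)).
Proof.
  intros hq.
  set (d := fun n => qpoch A q (S n) - qpoch A q n).
  assert (hd : ex_series (V := C_CompleteNormedModule) d).
  { apply (ex_series_le (V := C_CompleteNormedModule) d
      (fun n => (exp (Cmod A / (1 - Cmod q)) * Cmod A) * Cmod q ^ n)%R).
    - intros n. change (norm (d n)) with (Cmod (d n)).
      replace (d n) with (- (qpoch A q n * (A * q ^ n))) by (unfold d; simpl; ring).
      rewrite Cmod_opp, !Cmod_mult, Cmod_pow, <- Rmult_assoc.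
      apply Rmult_le_compat_r; [apply pow_le, Cmod_ge_0|].
      apply Rmult_le_compat_r; [apply Cmod_ge_0|].
      now apply qpoch_bound.
    - apply (ex_series_scal (K := R_AbsRing) (V := R_NormedModule)).
      apply ex_series_geom.
      rewrite Rabs_pos_eq; [exact hq | apply Cmod_ge_0]. }
  destruct hd as [l hl].
  (* The increments up to index [n] add up to [qpoch A q (S n) - 1], hence the added [1] and the
     index shift. *)
  assert (hlim : filterlim (qpoch A q) eventually (locally (l + 1))).
  { apply filterlim_C_Cmod, is_lim_seq_incr_1.
    apply (proj1 (filterlim_C_Cmod (fun n => qpoch A q (S n)) (l + 1))).
    apply filterlim_ext with (fun n => sum_n d n + 1).
    - intros n. induction n as [|n IH].
      + rewrite sum_O. unfold d; simpl; ring.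
      + rewrite sum_Sn. change plus with Cplus.
        transitivity (sum_n d n + 1 + d (S n)); [ring|].
        rewrite IH. unfold d. ring.
    - apply filterlim_C_plus; [exact hl | apply filterlim_const]. }
  (* Limits are unique, so [iota] selects the limit just found. *)
  unfold qpoch_inf.
  erewrite (iota_filterlim_locally (V := C_CompleteNormedModule)
              (qpoch A q) (l + 1)); [exact hlim | exact hlim].
Qed.

(** Nonzero factors alone do not keep an infinite product away from [0]. Splitting it with
    [qpoch_add] into a nonzero head and a tail starting at a small parameter gives a positive lower
    bound. *)
Lemma qpoch_inf_neq_0 (A q : C) :
  (Cmod q < 1)%R -> (forall k, 1 - A * q ^ k <> 0) -> qpoch_inf A q <> 0.
Proof.
  intros hq hk h0.
  pose proof (is_lim_seq_Cmod _ _ (qpoch_inf_lim A q hq)) as hlim.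
  rewrite h0, Cmod_0 in hlim.
  (* Past [m] the factors are so close to [1] that the tail product stays
     above [1/2]. *)
  assert (hm : exists m, (Cmod (A * q ^ m) < (1 - Cmod q) / 2)%R).
  { assert (hz : is_lim_seq (fun n => Cmod (A * q ^ n)) 0%R).
    { rewrite <- Cmod_0. replace (RtoC 0) with (A * 0) by ring.
      apply is_lim_seq_Cmod, filterlim_C_mult;
        [apply filterlim_const | now apply filterlim_C_pow]. }
    assert (he : (0 < (1 - Cmod q) / 2)%R) by lra.
    destruct (proj2 (is_lim_seq_spec _ _) hz (mkposreal _ he)) as [m Hm].
    exists m. specialize (Hm m (Nat.le_refl m)). simpl in Hm.
    rewrite Rminus_0_r, Rabs_pos_eq in Hm; [exact Hm | apply Cmod_ge_0]. }
  destruct hm as [m hm].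
  assert (hc : (0 < Cmod (qpoch A q m))%R) by now apply Cmod_gt_0, qpoch_neq_0.
  assert (hle : Rbar_le (Cmod (qpoch A q m) / 2)%R 0%R).
  { apply (is_lim_seq_le (fun _ => Cmod (qpoch A q m) / 2)%R
             (fun n => Cmod (qpoch A q (n + m)))).
    - intros n. rewrite Nat.add_comm, qpoch_add, Cmod_mult.
      apply Rmult_le_compat_l; [lra|].
      apply Rle_trans with (1 - Cmod (A * q ^ m) / (1 - Cmod q))%R;
        [|apply qpoch_lower_bound; lra].
      apply Rmult_le_reg_r with (1 - Cmod q)%R; [lra|].
      replace ((1 - Cmod (A * q ^ m) / (1 - Cmod q)) * (1 - Cmod q))%R
        with (1 - Cmod q - Cmod (A * q ^ m))%R by (field; lra).
      lra.
    - apply is_lim_seq_const.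
    - now apply (is_lim_seq_incr_n (fun n => Cmod (qpoch A q n))). }
  simpl in hle. lra.
Qed.

(** * The telescoping sum and its limit *)

Theorem theorem1p3 (q alpha gamma beta : C)
  (hq : (Cmod q < 1)%R)
  (hbeta0 : beta <> 0)
  (hbeta_alpha : beta <> alpha * q)
  (hbeta_gamma : beta <> gamma * q)
  (hbeta_pole : forall j : nat, beta <> / q ^ j)
  (hbeta_pole' : forall j : nat, beta <> alpha * gamma * q ^ (j + 2)) :
  is_series
    (fun n : nat =>
       qpoch alpha q n * qpoch gamma q n
       / (qpoch beta q n * qpoch (alpha * gamma * q ^ 2 / beta) q n) * q ^ n)
    (/ beta * q / ((1 - alpha * q / beta) * (1 - gamma * q / beta))
     * (qpoch_inf alpha q * qpoch_inf gamma q
        / (qpoch_inf beta q * qpoch_inf (alpha * gamma * q ^ 2 / beta) q))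
     + (1 - q / beta) * (1 - alpha * gamma * q / beta)
       / ((1 - gamma * q / beta) * (1 - alpha * q / beta))).
Proof.
  set (delta := alpha * gamma * q ^ 2 / beta).
  assert (hb : forall k, 1 - beta * q ^ k <> 0).
  { intros k E. apply (hbeta_pole k).
    assert (E1 : beta * q ^ k = 1).
    { replace (beta * q ^ k) with (1 - (1 - beta * q ^ k)) by ring.
      rewrite E; ring. }
    (* [q] may be [0], so the nonvanishing of [q ^ k] is drawn from [beta * q ^ k = 1]. *)
    assert (hqk : q ^ k <> 0).
    { intros E2. rewrite E2, Cmult_0_r in E1. now apply C1_nz. }
    transitivity (beta * q ^ k / q ^ k); [now field|].
    rewrite E1. now field. }
  assert (hd : forall k, 1 - delta * q ^ k <> 0).
  { intros k E. apply (hbeta_pole' k).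
    transitivity (beta * (1 - delta * q ^ k) + alpha * gamma * q ^ (k + 2)).
    - unfold delta. rewrite Cpow_add_r. now field.
    - rewrite E; ring. }
  (* These are [beta] times the two factors of [D], so [D] is nonzero. *)
  assert (hDa : beta - alpha * q <> 0) by now apply Cminus_eq_contra.
  assert (hDg : beta - gamma * q <> 0) by now apply Cminus_eq_contra.
  set (P := fun n => qpoch alpha q n * qpoch gamma q n
                     / (qpoch beta q n * qpoch delta q n)).
  set (D := (1 - alpha * q / beta) * (1 - gamma * q / beta)).
  (* [T] is the telescoping sequence written [S] in the overview. *)
  set (T := fun n => P n * ((q / beta - q ^ n)
                            * (1 - alpha * gamma * q / beta * q ^ n) / D)).
  assert (hsum : forall n, sum_n (fun n => P n * q ^ n) n = T (S n) - T O).
  { assert (hstep : forall n, P n * q ^ n = T (S n) - T n).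
    { intros n. unfold T, P, D. rewrite Cpow_S.
      simpl qpoch.
      pose proof (qpoch_neq_0 beta q n hb) as hbn.
      pose proof (qpoch_neq_0 delta q n hd) as hdn.
      pose proof (hb n) as hbn'. pose proof (hd n) as hdn'.
      set (B := qpoch beta q n) in *. set (E := qpoch delta q n) in *.
      set (x := q ^ n) in *.
      (* The factor [1 - delta * x] cleared of its denominator [beta], the form in which [field]
         asks for it. *)
      assert (hdn2 : beta - alpha * gamma * q ^ 2 * x <> 0).
      { intros F. apply hdn'. unfold delta.
        transitivity ((beta - alpha * gamma * q ^ 2 * x) / beta); [now field|].
        rewrite F. now field. }
      unfold delta. field.
      repeat split; assumption. }
    intros n. induction n as [|n IH].
    - rewrite sum_O. apply hstep.
    - rewrite sum_Sn, IH, hstep.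
      change (T (S n) - T O + (T (S (S n)) - T (S n)) = T (S (S n)) - T O).
      ring. }
  assert (hP : filterlim P eventually
     (locally (qpoch_inf alpha q * qpoch_inf gamma q
               / (qpoch_inf beta q * qpoch_inf delta q)))).
  { apply filterlim_C_mult.
    - apply filterlim_C_mult; now apply qpoch_inf_lim.
    - apply filterlim_C_inv.
      + apply Cmult_neq_0; now apply qpoch_inf_neq_0.
      + apply filterlim_C_mult; now apply qpoch_inf_lim. }
  set (L := qpoch_inf alpha q * qpoch_inf gamma q
            / (qpoch_inf beta q * qpoch_inf delta q)) in *.
  (* Both brackets of [T] are affine in [q ^ n]; writing them as [a + - b * q ^ n], with the limit
     left unsimplified, lets [haff] treat both. *)
  assert (hT : filterlim T eventually
     (locally (L * ((q / beta + - (1) * 0)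
                    * (1 + - (alpha * gamma * q / beta) * 0) / D)))).
  { pose proof (filterlim_C_pow q hq) as hpow.
    apply filterlim_ext with
      (fun n => P n * ((q / beta + - (1) * q ^ n)
                       * (1 + - (alpha * gamma * q / beta) * q ^ n) / D)).
    { intros n. unfold T, Cdiv. ring. }
    apply filterlim_C_mult; [exact hP|].
    assert (haff : forall a b : C, filterlim (fun n => a + - b * q ^ n)
                                     eventually (locally (a + - b * 0))).
    { intros a b. apply filterlim_C_plus; [apply filterlim_const|].
      apply filterlim_C_mult; [apply filterlim_const | exact hpow]. }
    apply filterlim_C_mult; [|apply filterlim_const].
    apply filterlim_C_mult; apply haff. }
  apply filterlim_ext with (fun n => T (S n) + - T O).
  { intros n. symmetry. apply hsum. }
  match goal with |- filterlim _ _ (locally ?r) =>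
    replace r with
      (L * ((q / beta + - (1) * 0)
            * (1 + - (alpha * gamma * q / beta) * 0) / D) + - T O)
  end.
  - apply filterlim_C_plus; [|apply filterlim_const].
    (* Passing to real sequences turns the shift from [T (S n)] to [T n] into
       [is_lim_seq_incr_1]. *)
    apply filterlim_C_Cmod.
    apply (is_lim_seq_incr_1 (fun n => Cmod (T n - _))).
    now apply filterlim_C_Cmod.
  - unfold T, P, D. simpl.
    field. repeat split; assumption.
Qed.
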